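(* Let $a\ge1$ and $0\le b<a$ be integers with $(a,b)\neq(1,0)$, and run the golden sieve on $W_0=a\mathbb{N}+b$. For every $n\ge1$, $$\delta_n=a\sigma_n+n+(b-1).$$ Equivalently, in the original scale, $d_n=a\delta_n+b=a\bigl(a\sigma_n+n+(b-1)\bigr)+b$.
   Context: $\mathbb{N}=\{1,2,3,\ldots\}$ and $a\mathbb{N}+b=\{an+b:n\ge1\}$, viewed as an increasing sequence. For a strictly increasing sequence $X$ of positive integers, $X(k)$ denotes its $k$-th term. Golden sieve: let $W_0=(w_1<w_2<\cdots)$ be an infinite strictly increasing sequence of positive integers. For $n\ge1$ define inductively $h_n:=W_{n-1}(n)$ (the pointer), $d_n:=W_{n-1}(h_n)$ (the deletion), and let $W_n$ be the increasing sequence obtained from $W_{n-1}$ by removing the value $d_n$. The survivor sequence $(s_n)_{n\ge1}$ is the increasing enumeration of $W_0\setminus\{d_1,d_2,\ldots\}$. Normalization for $W_0=a\mathbb{N}+b$: $\sigma_n:=(s_n-b)/a$ (normalized survivors) and $\delta_n:=(d_n-b)/a$ (normalized deletions). *)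

(* Defs.v *)
From mathcomp Require Import all_boot all_order all_algebra.
From mathcomp Require Import boolp classical_sets.

Set Implicit Arguments.
Unset Strict Implicit.
Unset Printing Implicit Defensive.

Import GRing.Theory.

Local Open Scope classical_set_scope.
Local Open Scope nat_scope.

(* Sequences are 1-indexed: [X : nat -> nat] stands for X(1), X(2), ...,
   and the value [X 0] is never used. *)
Definition positive : set nat := [set k | 0 < k].

Definition terms (X : nat -> nat) : set nat := X @` positive.

Definition increasing_seq (X : nat -> nat) : Prop :=
  forall i j, 0 < i -> i < j -> X i < X j.

(* For an infinite A the values at k >= 1 do not depend on the choice made by
   [xget]; for a finite A there is no enumeration and the result is constantly
   0. *)
Definition increasing_enum (A : set nat) : nat -> nat :=
  xget (fun=> 0) [set X : nat -> nat | increasing_seq X /\ terms X = A].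

Section GoldenSieve.
Variable W0 : nat -> nat.

Fixpoint sieve (n : nat) : nat -> nat :=
  if n is m.+1 then
    let X := sieve m in
    increasing_enum (terms X `\ X (X n))
  else W0.

(* h_n and d_n, meaningful for n >= 1; [sieve] removes [deletion n] at step n. *)
Definition pointer (n : nat) : nat := sieve n.-1 n.
Definition deletion (n : nat) : nat := sieve n.-1 (pointer n).

Definition survivor : nat -> nat :=
  increasing_enum (terms W0 `\` terms deletion).

End GoldenSieve.

Definition arith_prog (a b : nat) : nat -> nat := fun k => a * k + b.

Local Open Scope ring_scope.

(* x |-> (x - b) / a, as an exact rational. *)
Definition normalize (a b x : nat) : rat := (x%:R - b%:R) / a%:R.

Definition norm_survivor (a b n : nat) : rat :=
  normalize a b (survivor (arith_prog a b) n).

Definition norm_deletion (a b n : nat) : rat :=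
  normalize a b (deletion (arith_prog a b) n).

(* Main.v *)
Require Import Defs.
From mathcomp Require Import all_boot all_order all_algebra.
From mathcomp Require Import boolp classical_sets zify ring.

(** Let [W0 1 > 1], so that every term exceeds its index.  Then the pointer
    [h_n] exceeds [n], so step [n] and all later ones leave the first [n]
    terms alone; hence [h_n] is the [n]-th survivor and the pointers are
    strictly increasing.  Consequently the [n - 1] terms deleted before step
    [n] all sat at positions below [h_n], and [d_n = W0 (s_n + n - 1)].  For
    [W0 k = a k + b] this is the stated formula. *)

Set Implicit Arguments.
Unset Strict Implicit.
Unset Printing Implicit Defensive.

Import GRing.Theory Num.Theory.

Local Open Scope classical_set_scope.
Local Open Scope nat_scope.

Lemma increasing_seq_le X : increasing_seq X ->
  forall i j, 0 < i -> i <= j -> X i <= X j.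
Proof.
move=> incX i j i0; rewrite leq_eqVlt => /orP[/eqP -> //|ij].
by apply: ltnW; apply: incX.
Qed.

Lemma increasing_seq_inj X : increasing_seq X ->
  forall i j, 0 < i -> 0 < j -> X i = X j -> i = j.
Proof.
move=> incX i j i0 j0 eqX; case: (ltngtP i j) => // ij.
- by have := incX i j i0 ij; rewrite eqX ltnn.
- by have := incX j i j0 ij; rewrite eqX ltnn.
Qed.

Lemma increasing_seq_terms_inj X Y : increasing_seq X -> increasing_seq Y ->
  terms X = terms Y -> forall k, 0 < k -> X k = Y k.
Proof.
move=> incX incY eqXY k; elim/ltn_ind: k => k IH k0.
(* The bound is stated for an arbitrary pair so that it can be used in both directions. The value
   [Y' k] is some [X' j]; if [j < k], agreement below [k] would give [Y' j = Y' k], against strict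
   growth. *)
have le X' Y' : increasing_seq X' -> increasing_seq Y' ->
    terms X' = terms Y' -> (forall j, j < k -> 0 < j -> X' j = Y' j) ->
    X' k <= Y' k.
  move=> incX' incY' eqT eqlt.
  have : terms X' (Y' k) by rewrite eqT; exists k.
  move=> [j j0 Xj]; rewrite -Xj.
  case: (ltnP j k) => jk; last exact: increasing_seq_le.
  by have := incY' j k j0 jk; rewrite -eqlt // Xj ltnn.
apply/eqP; rewrite eqn_leq !le //.
by move=> j jk j0; rewrite IH.
Qed.

Lemma increasing_enumE X A : increasing_seq X -> terms X = A ->
  forall k, 0 < k -> increasing_enum A k = X k.
Proof.
move=> incX XA.
have [|incE EA] := @xgetPex _ (fun=> 0)
  [set Y : nat -> nat | increasing_seq Y /\ terms Y = A].
  by exists X.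
by apply: increasing_seq_terms_inj => //; rewrite XA.
Qed.

(** An explicit candidate for the enumeration that [sieve] obtains by choice; uniqueness identifies
    the two at indices from 1 on, so index 0 is never compared. *)
Definition skip (k : nat) (X : nat -> nat) : nat -> nat :=
  fun j => if j < k then X j else X j.+1.

Lemma skip_increasing k X : increasing_seq X -> increasing_seq (skip k X).
Proof.
move=> incX i j i0 ij; rewrite /skip.
by case: ifP => ik; case: ifP => jk; apply: incX => //; lia.
Qed.

Lemma terms_skip k X : increasing_seq X -> 0 < k ->
  terms (skip k X) = terms X `\ X k.
Proof.
move=> incX k0; apply/seteqP; split=> [v [j j0 <-]|v [[j j0 <-] neq]].
- rewrite /skip; have j0' : 0 < j by [].
  case: ifP => jk; (split; first by eexists; last reflexivity) => /= eqX.
  + by have := increasing_seq_inj incX j0' k0 eqX; lia.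
  + by have := increasing_seq_inj incX (ltn0Sn j) k0 eqX; lia.
- have j0' : 0 < j by [].
  case: (ltngtP j k) => jk.
  + by exists j => //; rewrite /skip jk.
  + exists j.-1; first by rewrite /positive /=; lia.
    by rewrite /skip ifF ?prednK //; lia.
  + by case: neq; rewrite jk.
Qed.

Section Sieve.
Variable W0 : nat -> nat.
Hypotheses (incW0 : increasing_seq W0) (W0_1 : 1 < W0 1).

Local Notation W := (sieve W0).

Lemma ltn_W0 j : 0 < j -> j < W0 j.
Proof.
elim: j => // -[_ _ //|j IH] _.
by apply: leq_ltn_trans (IH _) (incW0 _ _).
Qed.

(** The two claims need a joint induction: describing the next stage by [skip] takes monotonicity of
    the current one and a positive pointer, and the latter comes from the bound. *)
Lemma sieve_increasing_gt n :
  increasing_seq (W n) /\ forall j, 0 < j -> j < W n j.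
Proof.
elim: n => [|n [incW gtW]]; first by split=> //; apply: ltn_W0.
have p0 : 0 < W n n.+1 by apply: ltn_trans (gtW n.+1 _).
have E j : 0 < j -> W n.+1 j = skip (W n n.+1) (W n) j.
  by apply: increasing_enumE; [exact: skip_increasing|exact: terms_skip].
split=> [i j i0 ij|j j0].
- by rewrite !E ?(ltn_trans i0 ij) //; apply: skip_increasing.
- rewrite E // /skip; case: ifP => _; first exact: gtW.
  by apply: ltn_trans (gtW _ _).
Qed.

Lemma sieve_increasing n : increasing_seq (W n).
Proof. by have [] := sieve_increasing_gt n. Qed.

Lemma ltn_sieve n j : 0 < j -> j < W n j.
Proof. by have [_] := sieve_increasing_gt n; apply. Qed.

Lemma pointer_gt0 n : 0 < W n n.+1.
Proof. by apply: ltn_trans (ltn_sieve n _). Qed.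

Lemma sieveS n j : 0 < j -> W n.+1 j = skip (W n n.+1) (W n) j.
Proof.
apply: increasing_enumE; first exact/skip_increasing/sieve_increasing.
exact: terms_skip (@sieve_increasing n) (pointer_gt0 n).
Qed.

Lemma terms_sieveS n : terms (W n.+1) = terms (W n) `\ deletion W0 n.+1.
Proof.
rewrite -(terms_skip (@sieve_increasing n) (pointer_gt0 n)).
by apply/seteqP; split=> v [j j0 <-]; exists j => //; rewrite sieveS.
Qed.

Lemma pointer_ltS n : W n n.+1 < W n.+1 n.+2.
Proof.
(* The deleted position [W n n.+1] lies beyond [n.+1], so the old pointer remains the term at index
   [n.+1], just before the new one. *)
suff <- : W n.+1 n.+1 = W n n.+1 by apply: sieve_increasing.
by rewrite sieveS // /skip ltn_sieve.
Qed.

Lemma pointer_increasing : increasing_seq (pointer W0).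
Proof.
move=> [//|i] [//|j] _; rewrite ltnS /pointer /=.
elim: j => // j IH; rewrite ltnS leq_eqVlt => /orP[/eqP -> |/IH h].
  exact: pointer_ltS.
exact: ltn_trans h (pointer_ltS j).
Qed.

Lemma sieve_stable n m : n <= m -> W m n.+1 = W n n.+1.
Proof.
elim: m => [|m IH]; first by rewrite leqn0 => /eqP ->.
rewrite leq_eqVlt => /orP[/eqP -> //|nm].
rewrite sieveS // /skip ifT ?IH //.
exact: leq_ltn_trans nm (ltn_sieve m _).
Qed.

Lemma terms_sieve n :
  terms (W n) = terms W0 `\` [set v | exists2 i, 0 < i <= n & deletion W0 i = v].
Proof.
elim: n => [|n IH].
  apply/seteqP; split=> [v Wv|v []//]; split=> // -[i].
  by case: i.
rewrite terms_sieveS IH; apply/seteqP; split=> v.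
- move=> [[Wv nd] nv]; split=> // -[i /andP[i0]].
  rewrite leq_eqVlt => /orP[/eqP -> dv|lin dv]; first by case: nv.
  by apply: nd; exists i => //; rewrite i0.
- move=> [Wv nd]; split; first split=> //.
  + by move=> [i /andP[i0 lin] dv]; apply: nd; exists i; rewrite // i0 ltnW.
  + by move=> /= vd; apply: nd; exists n.+1; rewrite //= leqnn.
Qed.

Lemma terms_pointer : terms (pointer W0) = terms W0 `\` terms (deletion W0).
Proof.
apply/seteqP; split=> [v [[//|n] _ <-]|v [Wv nd]].
- have inW m : n <= m -> terms (W m) (pointer W0 n.+1).
    by move=> nm; exists n.+1 => //; rewrite sieve_stable.
  split; first by have := inW n (leqnn n); rewrite terms_sieve => -[].
  move=> [i i0 di].
  (* A stage past both [n] and [i] still contains the pointer but has already lost the [i]-th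
     deletion. *)
  have := inW (maxn n i) (leq_maxl _ _); rewrite terms_sieve => -[_].
  by apply; exists i => //; rewrite leq_maxr andbT.
(* Stage [v] is late enough: there [v] sits at an index smaller than [v], because terms exceed their
   indices, and that entry has been final since it became the pointer. *)
- have : terms (W v) v.
    rewrite terms_sieve; split=> // -[i /andP[i0 _] di].
    by apply: nd; exists i.
  move=> [[//|j] _ Wj]; exists j.+1 => //.
  rewrite /pointer /= -[RHS]Wj (@sieve_stable j v) //.
  by have := @ltn_sieve v j.+1 isT; rewrite Wj => /ltnW /ltnW.
Qed.

Lemma survivor_pointer n : 0 < n -> survivor W0 n = pointer W0 n.
Proof. exact: increasing_enumE pointer_increasing terms_pointer n. Qed.

Lemma sieve_shift n j : W n n.+1 <= j -> W n j = W0 (j + n).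
Proof.
elim: n j => [j _|n IH j hj]; first by rewrite addn0.
(* Since [j] is past the previous pointer, [skip] reads index [j.+1], which the induction hypothesis
   covers; each step thus adds exactly 1 to the shift. *)
have lt := leq_trans (pointer_ltS n) hj.
have j0 : 0 < j by apply: leq_trans lt.
rewrite sieveS // /skip ltnNge (ltnW lt) /= IH ?addSnnS //.
exact: leqW (ltnW lt).
Qed.

Lemma deletion_survivor n : 0 < n ->
  deletion W0 n = W0 (survivor W0 n + n.-1).
Proof.
by case: n => // n _; rewrite survivor_pointer // /deletion sieve_shift.
Qed.

End Sieve.

Local Open Scope ring_scope.

Theorem proposition3p5 (a b : nat) (ha : (1 <= a)%N) (hb : (b < a)%N)
    (hab : (a, b) <> (1%N, 0%N)) (n : nat) (hn : (1 <= n)%N) :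
  [/\ norm_deletion a b n =
        a%:R * norm_survivor a b n + n%:R + (b%:R - 1),
      (deletion (arith_prog a b) n)%:R = a%:R * norm_deletion a b n + b%:R
    & a%:R * norm_deletion a b n + b%:R =
        a%:R * (a%:R * norm_survivor a b n + n%:R + (b%:R - 1)) + b%:R].
Proof.
(* If [a] were 1, then [b < a] would force the excluded pair. This makes the first term [a + b]
   exceed 1, as the sieve lemmas require. *)
have a_gt1 : (1 < a)%N.
  case: a ha hb hab => [|[|a]] // _; rewrite ltnS leqn0 => /eqP -> h.
  by case: h.
have a0 : a%:R != 0 :> rat by rewrite pnatr_eq0 -lt0n.
have incW : increasing_seq (arith_prog a b).
  by move=> i j _ ij; rewrite /arith_prog ltn_add2r ltn_pmul2l.
have W1 : (1 < arith_prog a b 1)%N.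
  by rewrite /arith_prog muln1 (leq_trans a_gt1) ?leq_addr.
have E : norm_deletion a b n = a%:R * norm_survivor a b n + n%:R + (b%:R - 1).
  rewrite /norm_deletion /norm_survivor /normalize deletion_survivor //.
  (* Here [n] becomes the predecessor of the original index, so the deletion is [a * (s + n) + b]
     with [s] the survivor, and normalizing it leaves [s + n]. *)
  case: n hn => // n _; rewrite {1}/arith_prog natrD natrM natrD -natr1 /=.
  by field.
split; rewrite -?E //.
by rewrite /norm_deletion /normalize; field.
Qed.
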